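(* Let $d\ge 3$ and $n\ge 0$ be integers and let $\alpha>1$. Almost surely there exists an integer $M_0$ such that, for any integer $M\ge M_0$, the trajectory of any particle contributing to $A_n[\infty]$ and starting from a source of level larger than $M^\alpha$ does not visit the strip $\mathbb{Z}_M$.
   Context: Let $\mathcal{H}=\{0\}\times\mathbb{Z}^{d-1}\subset\mathbb{Z}^d$ (the set of sources). Use the norm $\|(z_1,\dots,z_d)\|=\max_i|z_i|$. The level $M$ is the set of sources $z\in\mathcal{H}$ with $\|z\|=M$. A particle sent from a source $z$, when the current aggregate is a finite set $A\subset\mathbb{Z}^d$, is a simple symmetric random walk on $\mathbb{Z}^d$ started at $z$ (independent of everything else) and stopped at the first time it is at a site not in $A$; the site where it stops is added to $A$ (if $z\notin A$ the particle stops immediately at $z$). Its trajectory is the path of the walk up to the stopping time. For an integer $n\ge 0$, the aggregates $(A_n[M])_{M\ge 0}$ are defined inductively: $A_n[0]$ is obtained from the empty set by sending $n$ particles successively from the origin; given $A_n[M-1]$, the aggregate $A_n[M]$ is obtained by sending successively $n$ particles from each source of level $M$, the sources being taken in lexicographical order. The sequence $(A_n[M])_{M\ge0}$ is increasing and $A_n[\infty]:=\bigcup_{M\ge 0}A_n[M]$; the particles contributing to $A_n[\infty]$ are all the particles sent in this construction. For real $x>0$: $\mathbb{Z}_x=\mathbb{Z}\times\{-\lfloor x\rfloor,\dots,\lfloor x\rfloor\}^{d-1}$ (strip). *)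

(* Defs.v *)
From HB Require Import structures.
From mathcomp Require Import all_boot all_order all_algebra finmap.
From mathcomp Require Import all_classical all_reals all_analysis.

Set Implicit Arguments.
Unset Strict Implicit.
Unset Printing Implicit Defensive.

Import Order.TTheory GRing.Theory Num.Theory.

Local Open Scope classical_set_scope.
Local Open Scope ring_scope.

Definition site (d : nat) := 'rV[int]_d.

HB.instance Definition _ (d : nat) := GRing.Zmodule.on (site d).
HB.instance Definition _ (d : nat) := isPointed.Build (site d) 0.
(* The sites carry the discrete sigma-algebra. *)
HB.instance Definition _ (d : nat) :=
  @isMeasurable.Build default_measure_display (site d)
    discrete_measurable discrete_measurable0
    discrete_measurableC discrete_measurableU.

Section Lattice.
Variable d : nat.
Implicit Types z : site d.

Definition norm z : nat := (\max_(i < d) `|z ord0 i|)%N.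

Definition source : {pred site d} :=
  [pred z : site d | [forall i : 'I_d, (val i == 0)%N ==> (z ord0 i == 0)]].

Definition strip (R : realType) (x : R) : set (site d) :=
  [set z | forall i : 'I_d, val i != 0%N ->
     - Num.floor x <= z ord0 i <= Num.floor x].

Definition box (M : nat) : seq (site d) :=
  [seq \row_i ((f i : nat)%:Z - M%:Z) | f : {ffun 'I_d -> 'I_(M.*2.+1)}].

Definition lexle z1 z2 : bool :=
  (([tuple z1 ord0 i | i < d] : d.-tuplelexi int)
     <= [tuple z2 ord0 i | i < d])%O.

Definition level (M : nat) : seq (site d) :=
  sort lexle [seq z <- box M | (z \in source) && (norm z == M)].

Lemma leq_norm z (i : 'I_d) : (`|z ord0 i| <= norm z)%N.
Proof. by rewrite /norm (bigD1 i)//= leq_maxl. Qed.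

Lemma mem_level (M : nat) z :
  (z \in level M) = (z \in source) && (norm z == M).
Proof.
rewrite mem_sort mem_filter; case: eqP => [zM|]; last by rewrite !andbF.
rewrite andbT; case: (z \in source) => //=.
have zi i : (`|z ord0 i| <= M)%N.
  by rewrite -zM leq_norm.
apply/mapP; exists [ffun i => inord (absz (z ord0 i + M%:Z))].
  by rewrite mem_enum.
apply/rowP => i; rewrite mxE ffunE.
have zM0 : 0 <= z ord0 i + M%:Z.
  rewrite -lerBlDr sub0r; move: (zi i); rewrite -lez_nat abszE.
  by rewrite ler_norml => /andP[].
have zM2 : (absz (z ord0 i + M%:Z)%R < M.*2.+1)%N.
  rewrite ltnS -lez_nat gez0_abs// -addnn PoszD lerD2r.
  by move: (zi i); rewrite -lez_nat abszE ler_norml => /andP[].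
by rewrite inordK// gez0_abs// addrK.
Qed.

Lemma uniq_level (M : nat) : uniq (level M).
Proof.
rewrite sort_uniq filter_uniq// map_inj_uniq ?enum_uniq// => f g /rowP fg.
apply/ffunP => i; apply/val_inj.
by move: (fg i); rewrite !mxE => /addIr[].
Qed.

Lemma sorted_level (M : nat) : sorted lexle (level M).
Proof. by apply: sort_sorted => x y; exact: le_total. Qed.

Lemma level0 : level 0 = [:: 0].
Proof.
have mem0 z : (z \in level 0) = (z == 0).
  rewrite mem_level; apply/andP/eqP => [[_ /eqP z0]|->].
    apply/rowP => i; rewrite mxE; apply/eqP; rewrite -absz_eq0 -leqn0.
    by apply: leq_trans (leq_norm z i) _; rewrite z0.
  split; first by apply/forallP => i; rewrite mxE eqxx implybT.
  by rewrite /norm big1// => i _; rewrite mxE.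
apply/perm_small_eq => //; apply: uniq_perm; rewrite ?uniq_level//.
by move=> z; rewrite mem0 inE.
Qed.

End Lattice.
Arguments source : clear implicits.
Arguments box : clear implicits.
Arguments level : clear implicits.

(* (z, k) is the k-th particle sent from z. *)
Definition particle (d n : nat) := (site d * 'I_n)%type.

Section Aggregation.
Variable d : nat.
Implicit Types (A : set (site d)) (w : nat -> site d).

(* The sites w 0, ..., w T, where T is the first exit time of A
   (T = +oo if w never leaves A). *)
Definition trajectory A w : set (site d) :=
  [set w t | t in [set t | forall s, (s < t)%N -> A (w s)]].

(* Adds the site at which w first exits A; a walk that never leaves A,
   which almost surely does not happen for finite A, adds nothing. *)
Definition settle A w : set (site d) :=
  A `|` [set w t | t in [set t | ~ A (w t) /\
                                 forall s, (s < t)%N -> A (w s)]].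

Variable n : nat.

Definition level_particles (M : nat) : seq (particle d n) :=
  [seq (z, k) | z <- level d M, k <- enum 'I_n].

Variable w : particle d n -> nat -> site d.

Definition send A (s : seq (particle d n)) : set (site d) :=
  foldl (fun B p => settle B (w p)) A s.

Fixpoint aggregate (M : nat) : set (site d) :=
  send (if M is M'.+1 then aggregate M' else set0) (level_particles M).

(* The current aggregate when p, a particle of level M, is sent. *)
Definition current_aggregate (M : nat) (p : particle d n) : set (site d) :=
  send (if M is M'.+1 then aggregate M' else set0)
       (take (index p (level_particles M)) (level_particles M)).

End Aggregation.

Section Randomness.
Variables (disp : measure_display) (Omega : measurableType disp).
Variables (R : realType) (P : probability Omega R).

Definition mutually_independent (disp' : measure_display)
    (T : measurableType disp') (I : choiceType) (D : set I)
    (X : I -> {RV P >-> T}) : Prop :=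
  forall (J : {fset I}) (B : I -> set T),
    [set` J] `<=` D -> (forall i, i \in J -> measurable (B i)) ->
    P (\bigcap_(i in [set` J]) (X i @^-1` B i)) =
    (\prod_(i <- J) P (X i @^-1` B i))%E.

Variables d n : nat.

Definition unit_step : set (site d) :=
  [set e | (\sum_(i < d) `|e ord0 i|)%N = 1%N].

(* X p t is the t-th increment of the walk of the particle p; only the
   particles whose starting point is a source matter. *)
Definition srw_increments (X : particle d n -> nat -> {RV P >-> site d}) :=
  (forall p t e, p.1 \in source d -> unit_step e ->
     distribution P (X p t) [set e] = (((2 * d)%:R)^-1)%:E) /\
  mutually_independent [set pt : particle d n * nat | pt.1.1 \in source d]
    (fun pt => X pt.1 pt.2).

Definition walk (X : particle d n -> nat -> {RV P >-> site d}) (omega : Omega)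
    (p : particle d n) (t : nat) : site d :=
  p.1 + \sum_(s < t) X p s omega.

End Randomness.

(* Main.v *)
Require Import Defs.
From mathcomp Require Import all_boot all_order all_algebra finmap.
From mathcomp Require Import all_classical all_reals all_analysis.
From mathcomp Require Import zify ring lra.

(** A particle of level L > M^alpha satisfies L > 2 M as soon as M is large,
so a visit to the strip of half-width M forces it to move by more than L / 2
along a coordinate on which its source has absolute value L, and to do so
before it leaves the current aggregate.  What matters about that aggregate is
its size: it has at most one site per particle already sent, hence O(L^(d-1))
sites.

Indeed the simple random walk gives mass O(t^(-d/2)) to each site at time t
([heat_kernel_bound]), so whatever the set of V sites in which it starts, it
is outside of it at time C V^(2/d) with probability at least 1/2, and it stays
in it during q such periods with probability at most 2^-q ([mean_confined]).
With V = O(L^(d-1)) the period is of order L^(2(d-1)/d), a smaller power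
than L^2.  One may therefore choose a time T that consists of many periods but
is still so short that the walk moves by L / 2 before T only with a
probability smaller than every power of L ([mean_far]).  The number of
particles is polynomial in L, so that summing over particles and over levels
is harmless, and the Borel-Cantelli lemma concludes.

Independence is used through finitely many steps only.  Reveal the first T
steps of the particles of level below K, in the order in which they are sent.
If every particle leaves its current aggregate within its T steps, these steps
determine all the aggregates involved; so the event that some particle stays
too long or goes too far is contained in an event on one long uniform word of
steps ([bad_run], [trajectory_good_run]).  Its mean is bounded particle by
particle, the aggregate being fixed by the preceding letters
([mean_bad_run]), and the product formula for cylinders turns this mean into a
probability ([word_event]).

Levels are grouped in blocks l^(4d) <= L < (l+1)^(4d).  In the block of
index l the period is l^(8d-7), there are l^3 of them, so that T = m^2 with
m = l^(4d-2), and the distance l^(4d) / 2 is at least 2 l m; the bad event has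
probability at most 2^-l for l large ([scales], [long_trajectory_event]). *)

Set Implicit Arguments.
Unset Strict Implicit.
Unset Printing Implicit Defensive.

Import Order.TTheory GRing.Theory Num.Theory.

Local Open Scope classical_set_scope.
Local Open Scope ring_scope.

(** * Averages over words *)

Section Mean.
Variables (R : realFieldType) (S : finType).
Implicit Types (f g : seq S -> R) (t : nat).

(** The expectation of [f] on [t] independent uniform letters of [S].  The
recursion on the first letter makes conditioning on a prefix ([mean_cat])
immediate. *)
Fixpoint mean t f : R :=
  if t is t'.+1 then (#|S|%:R)^-1 * \sum_(e : S) mean t' (fun w => f (e :: w))
  else f [::].

Lemma mean0 f : mean 0 f = f [::]. Proof. by []. Qed.

Lemma meanS t f :
  mean t.+1 f = (#|S|%:R)^-1 * \sum_(e : S) mean t (fun w => f (e :: w)).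
Proof. by []. Qed.

Lemma mean_le t f g :
  (forall w, size w = t -> f w <= g w) -> mean t f <= mean t g.
Proof.
elim: t f g => [|t IH] f g fg /=; first exact: fg.
apply: ler_wpM2l; first by rewrite invr_ge0 ler0n.
by apply: ler_sum => e _; apply: IH => w wt; apply: fg; rewrite /= wt.
Qed.

Lemma eq_mean t f g :
  (forall w, size w = t -> f w = g w) -> mean t f = mean t g.
Proof. by move=> fg; apply/le_anti/andP; split; apply: mean_le => w /fg->. Qed.

Lemma meanZ t c f : mean t (fun w => c * f w) = c * mean t f.
Proof.
elim: t f => [//|t IH] f /=; rewrite [RHS]mulrCA [in RHS]mulr_sumr.
by congr (_ * _); apply: eq_bigr => e _; rewrite IH.
Qed.

Lemma mean_sum (I : Type) (s : seq I) (P : pred I) t (F : I -> seq S -> R) :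
  mean t (fun w => \sum_(i <- s | P i) F i w) = \sum_(i <- s | P i) mean t (F i).
Proof.
elim: t F => [//|t IH] F /=; rewrite -mulr_sumr exchange_big /=.
by congr (_ * _); apply: eq_bigr => e _; rewrite IH.
Qed.

Lemma meanD t f g : mean t (fun w => f w + g w) = mean t f + mean t g.
Proof.
have := mean_sum [:: true; false] predT t (fun b => if b then f else g).
rewrite 2!big_cons big_nil /= addr0 => <-; apply: eq_mean => w _.
by rewrite 2!big_cons big_nil /= addr0.
Qed.

Lemma mean_cat s t f :
  mean (s + t) f = mean s (fun u => mean t (fun v => f (u ++ v))).
Proof.
by elim: s f => [//|s IH] f /=; congr (_ * _); apply: eq_bigr => e _; rewrite IH.
Qed.

Lemma mean_tuple t f :
  mean t f = (#|S|%:R)^-1 ^+ t * \sum_(w : t.-tuple S) f w.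
Proof.
elim: t f => [|t IH] f /=.
  rewrite expr0 mul1r (big_pred1 [tuple])// => w.
  by apply/esym/eqP; exact: tuple0.
rewrite exprS -mulrA; congr (_ * _); under eq_bigr do rewrite IH.
rewrite -mulr_sumr; congr (_ * _); rewrite pair_big/=.
rewrite (reindex (fun ew : S * t.-tuple S => cons_tuple ew.1 ew.2))//=.
exists (fun w => (thead w, behead_tuple w)) => [[e w] _|w _] /=.
  by congr (_, _); apply/val_inj.
by rewrite [w in RHS]tuple_eta; apply/val_inj.
Qed.

Hypothesis S0 : (0 < #|S|)%N.

Lemma mean_cst t c : mean t (fun=> c) = c.
Proof.
elim: t => [//|t IH] /=; rewrite IH sumr_const -[c *+ _]mulr_natl mulrA mulVf ?mul1r//.
by rewrite pnatr_eq0 -lt0n.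
Qed.

(** The variance is nonnegative. *)
Lemma mean_sqr t f : mean t f ^+ 2 <= mean t (fun w => f w ^+ 2).
Proof.
set a := mean t f.
have : 0 <= mean t (fun w => (f w - a) ^+ 2).
  by rewrite -(mean_cst t 0); apply: mean_le => w _; exact: sqr_ge0.
rewrite (_ : mean _ _ = mean t (fun w => f w ^+ 2 + ((- 2 * a) * f w + a ^+ 2))).
  by rewrite !meanD meanZ mean_cst -/a; nra.
by apply: eq_mean => w _; ring.
Qed.

End Mean.

(** For letters in a product, the sequence of first components and that of
second components are independent and uniform.  It is used to condition a walk
on the sequence of directions of its steps. *)
Lemma mean_pair (R : realFieldType) (I J : finType) t (f : seq (I * J) -> R) :
  mean t f = mean t (fun u : seq I => mean t (fun v : seq J => f (zip u v))).
Proof.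
elim: t f => [//|t IH] f /=.
rewrite card_prod natrM invfM -mulrA; congr (_ * _).
rewrite (eq_bigr (fun p : I * J => mean t (fun w => f ((p.1, p.2) :: w)))); last first.
  by case.
rewrite -(pair_bigA _ (fun i j => mean t (fun w => f ((i, j) :: w))))/=.
rewrite mulr_sumr; apply: eq_bigr => i _.
rewrite meanZ mean_sum; congr (_ * _); apply: eq_bigr => j _.
by rewrite IH.
Qed.

Arguments mean : simpl never.

(** * Size bias and the simple walk on the integers *)

Section SizeBias.
Variables (R : realFieldType) (S : finType).
Hypothesis S0 : (0 < #|S|)%N.

(** Functions of the numbers of occurrences of the letters. *)
Definition symmetric_on_words (g : seq S -> R) :=
  forall u v, perm_eq u v -> g u = g v.

(** Size bias.  By exchangeability each of the t+1 positions contributes the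
same amount to the expectation of N_k g, and one may suppose that the letter k
is at the front. *)
Lemma mean_count (k : S) t (g : seq S -> R) : symmetric_on_words g ->
  mean t.+1 (fun u => (count_mem k u)%:R * g u) =
  t.+1%:R / #|S|%:R * mean t (fun u => g (k :: u)).
Proof.
elim: t g => [|t IH] g gP.
  rewrite meanS mean0 (bigD1 k)//= mean0 /= eqxx big1 ?addr0 => [|e /negPf ek].
    by rewrite !mul1r.
  by rewrite mean0 /= ek mul0r.
have Sn0 : #|S|%:R != 0 :> R by rewrite pnatr_eq0 -lt0n.
rewrite meanS.
under eq_bigr => e _.
  rewrite (_ : mean _ _ = (e == k)%:R * mean t.+1 (fun u => g (e :: u)) +
     t.+1%:R / #|S|%:R * mean t (fun u => g (k :: e :: u))).
    over.
  rewrite -meanZ (_ : mean t (fun u => _) = mean t (fun u => g (e :: k :: u))).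
    rewrite -(IH (fun u => g (e :: u))); last first.
      by move=> u v uv; apply: gP; rewrite perm_cons.
    by rewrite -meanD; apply: eq_mean => u _; rewrite /= natrD mulrDl.
  apply: eq_mean => u _; apply: gP.
  exact/permPl/(perm_catCA [:: k] [:: e]).
rewrite big_split/= (bigD1 k)//= eqxx big1 ?addr0; last first.
  by move=> e /negPf ek; rewrite ek mul0r.
rewrite -mulr_sumr mul1r meanS.
by rewrite -[t.+2]addn1 natrD; field.
Qed.

(** [mean_count] applied to f / N_k, where f does not depend on N_k: a factor
1 / (N_k + 1) is worth #|S| / (t + 1), at the price of one more letter. *)
Lemma mean_div_count (k : S) t (f : seq S -> R) : symmetric_on_words f ->
  (forall u, 0 <= f u) -> (forall u, f (k :: u) = f u) ->
  mean t (fun u => (count_mem k u).+1%:R^-1 * f u) <=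
  #|S|%:R / t.+1%:R * mean t.+1 f.
Proof.
move=> fP f0 fk.
have Sn0 : #|S|%:R != 0 :> R by rewrite pnatr_eq0 -lt0n.
have tn0 : t.+1%:R != 0 :> R by rewrite pnatr_eq0.
pose g u := (count_mem k u)%:R^-1 * f u.
have gP : symmetric_on_words g.
  by move=> u v uv; rewrite /g (fP _ _ uv) (permP uv).
have := mean_count k t gP.
rewrite (@eq_mean _ _ t (fun u => g (k :: u))
   (fun u => (count_mem k u).+1%:R^-1 * f u)); last first.
  by move=> u _; rewrite /g fk /= eqxx add1n.
set m := mean t _ => h.
have -> : m = #|S|%:R / t.+1%:R *
    mean t.+1 (fun u => (count_mem k u)%:R * g u).
  by rewrite h mulrA mulf_div [X in X / _]mulrC mulfV ?mul1r// mulf_neq0.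
apply: ler_wpM2l; first by rewrite divr_ge0.
apply: mean_le => u _; rewrite /g mulrA.
have [->|c0] := eqVneq (count_mem k u) 0%N; first by rewrite !mul0r.
by rewrite mulfV ?mul1r// pnatr_eq0.
Qed.

(** The counts N_i are typically of order t / #|S|, and the product of the
1 / (N_i + 1) has an expectation of the corresponding order; [mean_div_count]
eliminates the letters one by one and avoids any concentration estimate. *)
Lemma mean_prod_inv_count (r : seq S) t : uniq r ->
  mean t (fun u => \prod_(i <- r) (count_mem i u).+1%:R^-1) <=
  (#|S|%:R / t.+1%:R : R) ^+ size r.
Proof.
elim: r t => [|k r IH] t /=.
  by move=> _; under eq_mean do rewrite big_nil; rewrite mean_cst.
move=> /andP[kr ur].
under eq_mean do rewrite big_cons.
apply: (le_trans (mean_div_count _ _ _ _)).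
- move=> u v uv; apply: eq_bigr => i _; by rewrite (permP uv).
- by move=> u; apply: prodr_ge0 => i _; rewrite invr_ge0.
- move=> u; apply: eq_big_seq => i ir /=.
  by rewrite (_ : k == i = false)//; apply/negbTE; apply: contraNneq kr => ->.
rewrite exprS; apply: ler_wpM2l; first by rewrite divr_ge0.
apply: (le_trans (IH _ ur)); apply: lerXn2r; rewrite ?nnegrE ?divr_ge0//.
by rewrite ler_wpM2l// lef_pV2 ?posrE ?ltr0n// ler_nat.
Qed.

End SizeBias.

Section OneDim.
Local Open Scope nat_scope.

Lemma leq_central_bin a k : 'C(a.*2, k) <= 'C(a.*2, a).
Proof.
have up j : 'C(a.*2, a + j) <= 'C(a.*2, a).
  elim: j => [|j IH]; first by rewrite addn0.
  apply: leq_trans IH; rewrite addnS.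
  have := mul_bin_left a.*2 (a + j); nia.
case: (leqP a k) => [ak|ka]; first by have := up (k - a); rewrite subnKC.
rewrite -bin_sub; last by lia.
by have := up (a - k); congr ('C(_, _) <= _); lia.
Qed.

(** The ratio of the two sides decreases with [a], since
(2a+1)(2a+3) <= (2a+2)^2. *)
Lemma central_bin_bound a : 'C(a.*2, a) ^ 2 * a.*2.+1 <= 4 ^ a.*2.
Proof.
elim: a => [//|a IH].
have e1 : 'C(a.+1.*2, a.+1) = 2 * 'C(a.*2.+1, a).
  by have := mul_bin_diag a.*2.+2 a; rewrite doubleS /=; nia.
have e2 : a.+1 * 'C(a.*2.+1, a) = a.*2.+1 * 'C(a.*2, a).
  have -> : 'C(a.*2.+1, a) = 'C(a.*2.+1, a.+1).
    by rewrite -bin_sub; [congr 'C(_, _); lia | lia].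
  by rewrite -mul_bin_diag.
have -> : 4 ^ a.+1.*2 = 16 * 4 ^ a.*2 by rewrite doubleS 2!expnS mulnA.
rewrite e1 -(leq_pmul2l (_ : 0 < a.+1 ^ 2)) ?expn_gt0// doubleS.
move: IH e2; set c := 'C(_, a); set b := 'C(_, a); set e := 4 ^ _ => IH e2.
have -> : a.+1 ^ 2 * ((2 * b) ^ 2 * a.*2.+3) =
    4 * (a.*2.+1 * a.*2.+3) * (c ^ 2 * a.*2.+1).
  transitivity (4 * (a.+1 * b) ^ 2 * a.*2.+3); first by ring.
  by rewrite e2; ring.
apply: leq_trans (leq_mul (leqnn _) IH) _.
rewrite [leqRHS]mulnA leq_mul2r; apply/orP; right.
by rewrite -muln2; lia.
Qed.

(** The factor 2 absorbs the odd case, in which Pascal's rule bounds the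
coefficient by twice the central one of the preceding row. *)
Lemma bin_bound m k : 'C(m, k) ^ 2 * m.+1 <= 2 * 4 ^ m.
Proof.
rewrite -[m](odd_double_half); set a := m./2; case: (odd m) => /=.
  rewrite add1n.
  have h : 'C(a.*2.+1, k) <= 2 * 'C(a.*2, a).
    case: k => [|k]; first by rewrite bin0 muln_gt0 bin_gt0; lia.
    by rewrite binS mulSn mul1n leq_add// leq_central_bin.
  have := central_bin_bound a.
  have -> : 4 ^ a.*2.+1 = 4 * 4 ^ a.*2 by rewrite expnS.
  move: h; set c := 'C(_, a); set b := 'C(_, k); set e := 4 ^ _.
  move=> h ce; rewrite -leq_sqr in h.
  have a2 : a.*2.+2 <= 2 * a.*2.+1 by lia.
  apply: leq_trans (leq_mul h a2) _.
  have -> : (2 * c) ^ 2 * (2 * a.*2.+1) = 8 * (c ^ 2 * a.*2.+1) by ring.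
  by rewrite (_ : 2 * (4 * e) = 8 * e) ?leq_mul2l//; ring.
rewrite add0n; apply: leq_trans (leq_pmull _ _) => //.
apply: leq_trans (central_bin_bound a).
by rewrite leq_mul2r leq_sqr leq_central_bin orbT.
Qed.
End OneDim.

Section SimpleWalk1.
Variable R : realFieldType.

(** The law at time [m] of the simple random walk on the integers. *)
Fixpoint srw1 (m : nat) (y : int) : R :=
  if m is m'.+1 then (srw1 m' (y - 1) + srw1 m' (y + 1)) / 2
  else (y == 0)%:R.

Lemma srw1_supp m y : srw1 m y != 0 ->
  exists2 k : nat, (k <= m)%N & y = k.*2%:Z - m%:Z.
Proof.
elim: m y => [|m IH] y /=.
  by case: (eqVneq y 0) => [-> _|_]; [exists 0%N | rewrite eqxx].
case: (eqVneq (srw1 m (y - 1)) 0) => [->|/IH[k km yk] _].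
  case: (eqVneq (srw1 m (y + 1)) 0) => [->|/IH[k km yk] _].
    by rewrite addr0 mul0r eqxx.
  by exists k; lia.
by exists k.+1; lia.
Qed.

Lemma srw1_bin m (k : nat) : srw1 m (k.*2%:Z - m%:Z) = 'C(m, k)%:R / 2 ^+ m.
Proof.
elim: m k => [|m IH] k /=.
  rewrite subr0 expr0 divr1; case: k => [//|k]; by rewrite bin0n.
have -> : k.*2%:Z - m.+1%:Z + 1 = k.*2%:Z - m%:Z by lia.
rewrite IH; case: k => [|k].
  (* For k = 0 the left neighbour -m-2 is out of reach in m steps. *)
  rewrite (_ : srw1 _ _ = 0) ?bin0 ?add0r.
    by rewrite exprS invfM; ring.
  by apply/eqP/negPn/negP => /srw1_supp[k km]; lia.
have -> : k.+1.*2%:Z - m.+1%:Z - 1 = k.*2%:Z - m%:Z by lia.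
by rewrite IH binS natrD exprS invfM; ring.
Qed.

Lemma srw1_bound m y : srw1 m y ^+ 2 <= 2 * m.+1%:R^-1.
Proof.
case: (eqVneq (srw1 m y) 0) => [->|/srw1_supp[k _ ->]].
  by rewrite expr0n mulr_ge0// invr_ge0.
rewrite srw1_bin expr_div_n ler_pdivlMr ?ltr0n// mulrAC ler_pdivrMr ?exprn_gt0//.
rewrite -exprM mulnC exprM -!natrX -!natrM ler_nat.
exact: bin_bound.
Qed.

End SimpleWalk1.

(** * The heat kernel bound *)

Section LatticeWord.
Variables (R : realFieldType) (d : nat).
Implicit Types (w : seq ('I_d * bool)) (z x : site d).

(** The letter (i, b) encodes the step (-1)^b along the i-th axis. *)
Definition step_vec (e : 'I_d * bool) : site d :=
  \row_j (if e.1 == j then (-1) ^+ e.2 else 0).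

Definition displacement w : site d := \sum_(e <- w) step_vec e.

Lemma displacement_cons e w : displacement (e :: w) = step_vec e + displacement w.
Proof. by rewrite /displacement big_cons. Qed.

Lemma displacement_cat u w :
  displacement (u ++ w) = displacement u + displacement w.
Proof. by rewrite /displacement big_cat. Qed.

(** Once the directions are given, the coordinates are independent
one-dimensional walks, the i-th one with as many steps as there are
occurrences of i. *)
Lemma mean_sign_displacement (u : seq 'I_d) x :
  mean (size u) (fun v : seq bool => (displacement (zip u v) == x)%:R : R) =
  \prod_(i < d) srw1 R (count_mem i u) (x ord0 i).
Proof.
elim: u x => [|i u IH] x.
  rewrite mean0 /displacement big_nil /=.
  have [<-|x0] := eqVneq 0 x; first by rewrite big1// => i _; rewrite mxE eqxx.
  have [i xi] : exists i, x ord0 i != 0.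
    apply/existsP; apply: contraNT x0; rewrite negb_exists => /forallP xi.
    by apply/eqP/rowP => i; rewrite mxE; apply/esym/eqP; move/negPn: (xi i).
  by rewrite (bigD1 i)//= (negPf xi) mul0r.
rewrite meanS card_bool big_bool /=.
have E b : mean (size u) (fun v => (displacement (zip (i :: u) (b :: v)) == x)%:R) =
    (\prod_(j < d | j != i) srw1 R (count_mem j u) (x ord0 j)) *
    srw1 R (count_mem i u) (x ord0 i - (-1) ^+ b).
  rewrite (eq_mean (g := fun v => (displacement (zip u v) == x - step_vec (i, b))%:R)).
    rewrite IH (bigD1 i)//= mulrC; congr (_ * _).
      apply: eq_bigr => j /negPf ji; congr (srw1 _ _ _).
      by rewrite !mxE /= eq_sym ji subr0.
    by congr (srw1 _ _ _); rewrite !mxE /= eqxx.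
  move=> v _; rewrite /= displacement_cons.
  rewrite -[in RHS](inj_eq (addrI (step_vec (i, b)))).
  by rewrite [_ + (x - _)]addrC subrK.
rewrite !E [RHS](bigD1 i)//= eqxx add1n /= expr0 expr1 opprK.
rewrite [X in _ = _ * X](eq_bigr (fun j => srw1 R (count_mem j u) (x ord0 j)));
  last first.
  by move=> j /negPf ji; rewrite eq_sym ji add0n.
by field.
Qed.

Hypothesis d0 : (0 < d)%N.

Lemma card_steps : #|{: 'I_d * bool}| = (2 * d)%N.
Proof. by rewrite card_prod card_ord card_bool mulnC. Qed.

Lemma card_steps_gt0 : (0 < #|{: 'I_d * bool}|)%N.
Proof. by rewrite card_steps muln_gt0. Qed.

(** The return probability bound O(t^(-d/2)), squared: condition on the
directions, move the square inside by Cauchy-Schwarz so that the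
one-dimensional bound 2 / (N_i + 1) applies, then average the product. *)
Lemma heat_kernel_bound t x :
  mean t (fun w => (displacement w == x)%:R : R) ^+ 2 <=
  ((2 * d)%:R / t.+1%:R) ^+ d.
Proof.
have cI : (0 < #|'I_d|)%N by rewrite card_ord.
rewrite mean_pair.
rewrite (eq_mean (g := fun u => \prod_(i < d) srw1 R (count_mem i u) (x ord0 i)));
  last by move=> u <-; rewrite mean_sign_displacement.
apply: (le_trans (mean_sqr cI _ _)).
apply: (@le_trans _ _ (mean t (fun u : seq 'I_d =>
    2 ^+ d * \prod_(i < d) (count_mem i u).+1%:R^-1))).
  apply: mean_le => u _.
  rewrite -prodrXl -[d in 2 ^+ d]card_ord -prodr_const -big_split/=.
  by apply: ler_prod => i _; rewrite sqr_ge0 srw1_bound.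
rewrite meanZ natrM -mulrA exprMn; apply: ler_wpM2l; first exact: exprn_ge0.
have := mean_prod_inv_count R cI t (index_enum_uniq 'I_d).
by rewrite -[index_enum _]enumT -cardE card_ord.
Qed.

(** Union bound over the sites of [A], each of which has mass at most
c / |A| by [heat_kernel_bound]. *)
Lemma mean_in_seq t (A : seq (site d)) z (c : R) : 0 <= c ->
  (size A)%:R ^+ 2 * ((2 * d)%:R / t.+1%:R) ^+ d <= c ^+ 2 ->
  mean t (fun w => (z + displacement w \in A)%:R : R) <= c.
Proof.
move=> c0 hc.
apply: (@le_trans _ _ (mean t (fun w =>
    \sum_(a <- A) (displacement w == a - z)%:R))).
  apply: mean_le => w _; case: (boolP (_ \in A)) => [zA|_]; last first.
    by apply: sumr_ge0 => a _; rewrite ler0n.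
  rewrite (big_rem _ zA)/= [z + _]addrC addrK eqxx lerDl.
  by apply: sumr_ge0 => a _; rewrite ler0n.
rewrite mean_sum.
have [->|A0] := eqVneq A [::]; first by rewrite big_nil.
have sA : 0 < (size A)%:R :> R by rewrite ltr0n lt0n size_eq0.
apply: (@le_trans _ _ (\sum_(a <- A) c / (size A)%:R)); last first.
  by rewrite big_const_seq count_predT iter_addr_0 -[leLHS]mulr_natr divfK// gt_eqF.
apply: ler_sum => a _; rewrite ler_pdivlMr// -ler_sqr ?nnegrE//; last first.
  rewrite mulr_ge0// -(mean_cst card_steps_gt0 t (0 : R)).
  by apply: mean_le => w _; rewrite ler0n.
apply: le_trans hc; rewrite exprMn mulrC.
by apply: ler_wpM2l; [exact: sqr_ge0 | exact: heat_kernel_bound].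
Qed.

End LatticeWord.

(** * Confinement, displacement and bad runs *)

Section Words.
Variable d : nat.
Implicit Types (w : seq ('I_d * bool)) (z : site d) (A : seq (site d)).

Definition visited z w : seq (site d) :=
  mkseq (fun k => z + displacement (take k w)) (size w).+1.

Definition confined A z w := all (mem A) (visited z w).

(** Meaningful when the walk is not confined: otherwise [find] returns the
length of the list and the default value [z] is obtained. *)
Definition exit_site A z w : site d :=
  nth z (visited z w) (find (predC (mem A)) (visited z w)).

Definition far (r : nat) w :=
  has (fun y : site d => [exists i, (r <= `|y ord0 i|)%N]) (visited 0 w).

Definition bad (r : nat) A z w := confined A z w || far r w.

(** As long as no block of [T] letters has been bad, each walk has left the
list [A] within its block, at the site added to the list; so [A] is then the
aggregate found by the next walk. *)
Fixpoint bad_run (r T : nat) A (zs : seq (site d)) w :=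
  if zs is z :: zs' then
    bad r A z (take T w) ||
    bad_run r T (exit_site A z (take T w) :: A) zs' (drop T w)
  else false.

Lemma size_visited z w : size (visited z w) = (size w).+1.
Proof. by rewrite size_mkseq. Qed.

Lemma nth_visited y z w k : (k <= size w)%N ->
  nth y (visited z w) k = z + displacement (take k w).
Proof. by move=> kw; rewrite nth_mkseq. Qed.

Lemma visited_cat z u v :
  visited z (u ++ v) =
  [seq z + displacement (take k u) | k <- iota 0 (size u)] ++
  visited (z + displacement u) v.
Proof.
rewrite /visited /mkseq size_cat -addnS iotaD map_cat; congr (_ ++ _).
  apply/eq_in_map => k; rewrite mem_iota add0n /= => ku.
  by rewrite take_cat ku.
rewrite add0n -[X in iota X]addn0 iotaDl -map_comp; apply/eq_map => k /=.
by rewrite take_cat ltnNge leq_addr /= addKn displacement_cat addrA.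
Qed.

Lemma confined_cat A z u v :
  confined A z (u ++ v) ->
  (z + displacement u \in A) && confined A (z + displacement u) v.
Proof.
rewrite /confined visited_cat all_cat => /andP[_ Av]; rewrite Av andbT.
move/allP: Av; apply; apply/mapP; exists 0%N; first by rewrite mem_iota.
by rewrite take0 /displacement big_nil addr0.
Qed.

End Words.

Section Estimates.
Variables (R : realFieldType) (d : nat).
Hypothesis d0 : (0 < d)%N.
Implicit Types (w : seq ('I_d * bool)) (z : site d) (A : seq (site d)).
Let step := ('I_d * bool)%type.
Let cst (c : R) t : mean t (fun _ : seq step => c) = c := mean_cst (card_steps_gt0 d0) t c.

(** After each period of length [t] the walk is in [A] with conditional
probability at most 1/2, wherever it was at the beginning of the period. *)
Lemma mean_confined A z t q :
  (4 * size A ^ 2 * (2 * d) ^ d <= t.+1 ^ d)%N ->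
  mean (q * t) (fun w => (confined A z w)%:R : R) <= 2^-1 ^+ q.
Proof.
move=> At.
have inA y : mean t (fun w => (y + displacement w \in A)%:R : R) <= 2^-1.
  apply: (mean_in_seq d0); first by rewrite invr_ge0.
  rewrite expr_div_n mulrA ler_pdivrMr ?exprn_gt0// exprVn.
  rewrite ler_pdivlMl ?exprn_gt0// -!natrX -!natrM ler_nat; apply: leq_trans At.
  by rewrite mulnA.
elim: q z => [|q IH] z.
  by rewrite mul0n mean0 expr0 lern1 leq_b1.
rewrite mulSn mean_cat exprS mulrC.
apply: (@le_trans _ _ (mean t (fun u : seq step =>
    2^-1 ^+ q * (z + displacement u \in A)%:R))).
  apply: mean_le => u _.
  apply: (@le_trans _ _ (mean (q * t) (fun v : seq step =>
      (z + displacement u \in A)%:R * (confined A (z + displacement u) v)%:R))).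
    apply: mean_le => v _; rewrite -natrM mulnb ler_nat.
    by case: (boolP (confined A z (u ++ v))) => // /confined_cat ->.
  by rewrite meanZ mulrC ler_wpM2r.
by rewrite meanZ ler_wpM2l ?exprn_ge0 ?invr_ge0.
Qed.

Lemma mean_prod (phi : step -> R) t :
  mean t (fun w => \prod_(e <- w) phi e) =
  ((\sum_(e : step) phi e) / (2 * d)%:R) ^+ t.
Proof.
elim: t => [|t IH]; first by rewrite mean0 big_nil expr0.
rewrite meanS exprS -IH card_steps [_ / _]mulrC -mulrA; congr (_ * _).
rewrite mulr_suml; apply: eq_bigr => e _; rewrite -meanZ.
by apply: eq_mean => w _; rewrite big_cons.
Qed.

Lemma mean_take (f : seq step -> R) t T : (t <= T)%N ->
  mean T (fun w => f (take t w)) = mean t f.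
Proof.
move=> tT; rewrite -(subnKC tT) mean_cat; apply: eq_mean => u <-.
by rewrite -[RHS](cst (f u) (T - size u)); apply: eq_mean => v _; rewrite take_size_cat.
Qed.

(** (1 + y)^t (1 - t y) <= 1, because (1 + y) (1 - (t+1) y) <= 1 - t y. *)
Lemma bernoulli_inv (y : R) t : 0 <= y -> t%:R * y <= 2^-1 -> (1 + y) ^+ t <= 2.
Proof.
move=> y0 ty.
have h : (1 + y) ^+ t * (1 - t%:R * y) <= 1.
  elim: t {ty} => [|t IH]; first by rewrite expr0 mul0r subr0 mulr1.
  apply: le_trans IH; rewrite exprSr -mulrA ler_wpM2l//.
    by rewrite exprn_ge0// addr_ge0.
  rewrite -addn1 natrD; have : 0 <= t%:R :> R by rewrite ler0n.
  by move: (t%:R) => s s0; nra.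
have p0 : 0 <= (1 + y) ^+ t by rewrite exprn_ge0// addr_ge0.
by move: h p0 ty; move: ((1 + y) ^+ t) (t%:R * y) => p s; nra.
Qed.

Lemma bernoulli (x : R) t : 0 <= x -> 1 + t%:R * x <= (1 + x) ^+ t.
Proof.
move=> x0; elim: t => [|t IH]; first by rewrite expr0 mul0r addr0.
rewrite exprSr.
have x1 : 0 <= 1 + x by rewrite addr_ge0.
apply: le_trans (ler_wpM2r x1 IH).
rewrite -addn1 natrD; have : 0 <= t%:R :> R by rewrite ler0n.
by move: (t%:R) => s s0; nra.
Qed.

(** Exponential moments of a coordinate: one step multiplies the expectation
by at most 1 + x^2 / 2, because a + 1/a <= 2 + x^2 for a = 1 + x. *)
Lemma mean_exp_coord (x : R) (i : 'I_d) (s : bool) t :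
  0 <= x -> t%:R * x ^+ 2 <= 1 ->
  mean t (fun w => (1 + x) ^ ((-1) ^+ s * displacement w ord0 i)) <= 2.
Proof.
move=> x0 tx.
have a0 : 0 < 1 + x by rewrite ltr_wpDr.
have an0 : 1 + x != 0 by rewrite gt_eqF.
pose phi (e : step) := (1 + x) ^ ((-1) ^+ s * step_vec e ord0 i).
rewrite (eq_mean (g := fun w => \prod_(e <- w) phi e)); last first.
  move=> w _; elim: w => [|e w IH].
    by rewrite /displacement !big_nil mxE mulr0 expr0z.
  by rewrite big_cons -IH displacement_cons mxE mulrDr expfzDr.
rewrite mean_prod.
have d2 : 0 < (2 * d)%:R :> R by rewrite ltr0n muln_gt0.
have y0 : 0 <= x ^+ 2 / 2 by rewrite divr_ge0// sqr_ge0.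
apply: le_trans (bernoulli_inv (t := t) y0 _); last first.
  by rewrite mulrA ler_pdivrMr// mulVf.
apply: lerXn2r; rewrite ?nnegrE ?addr_ge0//.
  by rewrite divr_ge0 ?ler0n// sumr_ge0// => e _; rewrite exprz_ge0// ltW.
rewrite ler_pdivrMr// (eq_bigr (fun e : step => phi (e.1, e.2))); last by case.
rewrite -(pair_bigA _ (fun j b => phi (j, b)))/=.
apply: (@le_trans _ _ (\sum_(j < d) (2 + x ^+ 2))); last first.
  by rewrite sumr_const card_ord natrM -mulr_natr; lra.
apply: ler_sum => j _; rewrite big_bool/= /phi !mxE /=.
have [_|ji] := eqVneq j i; last by rewrite mulr0 expr0z ler_wpDr ?sqr_ge0//; lra.
have inv : (1 + x)^-1 <= 1 - x + x ^+ 2.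
  by rewrite -[_^-1]mul1r ler_pdivrMr//; nra.
by case: s {phi}; rewrite ?expr0 ?expr1 ?mulr1 ?mul1r ?mulrNN ?mul1r expr1z -invr_expz ?expr1z; lra.
Qed.

(** Markov's inequality for the exponential moments with x = 1/m, for each
time, coordinate and sign; here (1 + 1/m)^r >= 2^k since (1 + 1/m)^m >= 2. *)
Lemma mean_far (m k r T : nat) : (0 < m)%N -> (T <= m ^ 2)%N -> (k * m <= r)%N ->
  mean T (fun w => (far r w)%:R : R) <= (4 * d * T.+1)%:R * 2^-1 ^+ k.
Proof.
move=> m0 Tm kmr.
have mR : 0 < m%:R :> R by rewrite ltr0n.
pose x : R := m%:R^-1.
have x0 : 0 <= x by rewrite invr_ge0.
have a1 : 1 <= 1 + x by rewrite lerDl.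
have ak : 2 ^+ k <= (1 + x) ^+ r.
  apply: (@le_trans _ _ ((1 + x) ^+ (k * m))); last exact: ler_weXn2l.
  rewrite mulnC exprM; apply: lerXn2r; rewrite ?nnegrE ?exprn_ge0//.
    by rewrite addr_ge0.
  by apply: le_trans (bernoulli m x0); rewrite /x mulfV ?gt_eqF.
pose G (i : 'I_d) (s : bool) w := (1 + x) ^ ((-1) ^+ s * displacement w ord0 i).
have G0 i s w : 0 <= G i s w by rewrite exprz_ge0// addr_ge0.
have step1 w : size w = T -> (far r w)%:R <= 2^-1 ^+ k *
    \sum_(t < T.+1) \sum_(i < d) \sum_(s : bool) G i s (take t w).
  move=> wT; have S0 (t : 'I_T.+1) : 0 <= \sum_(i < d) \sum_(s : bool) G i s (take t w).
    by apply: sumr_ge0 => i _; apply: sumr_ge0.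
  case: (boolP (far r w)) => [|_]; last first.
    by rewrite mulr_ge0 ?exprn_ge0 ?invr_ge0// sumr_ge0.
  move=> /hasP[y /mapP[t]]; rewrite mem_iota add0n leq0n /= wT => tT -> /existsP[i].
  rewrite add0r => ri.
  rewrite exprVn ler_pdivlMl ?exprn_gt0// mulr1.
  rewrite (bigD1 (Ordinal tT))//= (bigD1 i)//=.
  rewrite -addrA ler_wpDr//.
    by rewrite addr_ge0// sumr_ge0// => j _; rewrite sumr_ge0.
  apply: (le_trans ak).
  set D := displacement _ ord0 i in ri *.
  (* The sign for which the exponent is the absolute value of the coordinate. *)
  rewrite (bigD1 (D < 0))//= ler_wpDr ?sumr_ge0//.
  rewrite /G -/D exprnP ler_weXz2l//.
  by rewrite -normrEsign -abszE lez_nat.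
apply: (le_trans (mean_le step1)).
rewrite meanZ mulrC ler_wpM2r ?exprn_ge0 ?invr_ge0// mean_sum.
apply: (@le_trans _ _ (\sum_(t < T.+1) \sum_(i < d) \sum_(s : bool) 2)); last first.
  rewrite !sumr_const !card_ord card_bool -!mulrnA ler_nat.
  by lia.
apply: ler_sum => t _; rewrite mean_sum; apply: ler_sum => i _.
rewrite mean_sum; apply: ler_sum => s _.
rewrite (mean_take (fun w => G i s w)); last by rewrite -ltnS.
apply: mean_exp_coord => //.
rewrite /x exprVn ler_pdivrMr ?exprn_gt0// mul1r -natrX ler_nat.
by apply: leq_trans Tm; rewrite -ltnS.
Qed.

Lemma mean_bad (m k r t q : nat) A z :
  (4 * size A ^ 2 * (2 * d) ^ d <= t.+1 ^ d)%N ->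
  (0 < m)%N -> (q * t <= m ^ 2)%N -> (k * m <= r)%N -> (k <= q)%N ->
  mean (q * t) (fun w => (bad r A z w)%:R : R) <=
  (1 + 4 * d * (q * t).+1)%:R * 2^-1 ^+ k.
Proof.
move=> At m0 Tm kmr kq.
apply: (@le_trans _ _ (mean (q * t)
    (fun w => (confined A z w)%:R + (far r w)%:R))).
  apply: mean_le => w _; rewrite -natrD ler_nat /bad.
  by case: confined; case: far.
rewrite meanD natrD mulrDl lerD ?(mean_far m0)// mul1r.
apply: (le_trans (mean_confined z q At)).
by rewrite ler_wiXn2l// ?invr_ge0// invf_le1// ler1n.
Qed.

(** The aggregate found by a walk depends on the preceding blocks only and has
at most [N] sites, so that each walk costs at most [delta]. *)
Lemma mean_bad_run (r T N : nat) (delta : R) A zs :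
  (forall B z, (size B <= N)%N -> mean T (fun w => (bad r B z w)%:R : R) <= delta) ->
  (size A + size zs <= N)%N ->
  mean (size zs * T) (fun w => (bad_run r T A zs w)%:R : R) <=
  (size zs)%:R * delta.
Proof.
move=> badB; elim: zs A => [|z zs IH] A AN; first by rewrite mean0 mul0r.
rewrite [size _]/= mulSn mean_cat -natr1 addrC mulrDl mul1r.
apply: (@le_trans _ _ (mean T (fun u =>
    (bad r A z u)%:R + (size zs)%:R * delta))).
  apply: mean_le => u uT.
  apply: (@le_trans _ _ (mean (size zs * T) (fun v => (bad r A z u)%:R +
    (bad_run r T (exit_site A z u :: A) zs v)%:R))).
    apply: mean_le => v _; rewrite /= take_size_cat// drop_size_cat//.
    by rewrite -natrD ler_nat; case: bad; case: bad_run.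
  rewrite meanD cst lerD2l; apply: IH.
  by move: AN => /=; rewrite addnS.
rewrite meanD cst lerD2r; apply: badB.
by apply: leq_trans AN; rewrite leq_addr.
Qed.

End Estimates.

Arguments confined : simpl never.
Arguments far : simpl never.
Arguments bad : simpl never.

(** * From words to probabilities *)

Lemma step_vec_inj d : injective (@step_vec d).
Proof.
move=> [i a] [j b] /rowP e.
have ij : i = j.
  have := e i; rewrite !mxE /= eqxx; case: (eqVneq j i) => [->//|_].
  by move/eqP; rewrite signr_eq0.
rewrite -ij in e *; congr (_, _); have := e i; rewrite !mxE /= eqxx.
by case: a {e}; case: b.
Qed.

Lemma unit_step_vec d (e : 'I_d * bool) : unit_step (step_vec e).
Proof.
rewrite /unit_step /= (bigD1 e.1)//= mxE eqxx big1 ?addn0.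
  by case: e => i [].
by move=> j /negPf je; rewrite mxE eq_sym je.
Qed.

Section Cylinders.
Variables (disp : measure_display) (Omega : measurableType disp).
Variables (R : realType) (P : probability Omega R) (d n : nat).
Variable X : particle d n -> nat -> {RV P >-> site d}.
Hypothesis d0 : (0 < d)%N.
Hypothesis XP : srw_increments X.
Let step := ('I_d * bool)%type.
Implicit Types idx : seq (particle d n * nat).

Definition increments (om : Omega) idx : seq (site d) :=
  [seq X i.1 i.2 om | i <- idx].

Definition cylinder idx (w : seq step) : set Omega :=
  [set om | increments om idx = map (@step_vec d) w].

Let e0 : step := (Ordinal d0, false).

(** The form to which the product formula of mutual independence applies. *)
Lemma cylinderE idx (w : seq step) : uniq idx -> size w = size idx ->
  cylinder idx w = \bigcap_(i in [set` [fset i in idx]%fset])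
    (X i.1 i.2 @^-1` [set step_vec (nth e0 w (index i idx))]).
Proof.
move=> uidx wi; apply/seteqP; split=> om /=.
  rewrite /cylinder/= => h i /=; rewrite inE => ii.
  rewrite -(nth_map e0 0) ?wi ?index_mem// -h (nth_map i) ?index_mem//.
  by rewrite nth_index.
move=> h; apply: (@eq_from_nth _ 0); rewrite !size_map// => k ki.
have [p _] : exists p, p \in idx.
  by case: idx ki {uidx wi h} => // p s _; exists p; rewrite mem_head.
rewrite (nth_map p)// (nth_map e0) ?wi//.
have := h (nth p idx k); rewrite /= inE mem_nth// => /(_ isT).
by rewrite index_uniq.
Qed.

Lemma measurable_increment i (x : site d) :
  measurable (X i.1 i.2 @^-1` [set x]).
Proof. by rewrite -[X in measurable X]setTI; exact: measurable_funP. Qed.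

Lemma measurable_cylinder idx w : uniq idx -> size w = size idx ->
  measurable (cylinder idx w).
Proof.
move=> uidx wi; rewrite cylinderE//; apply: fin_bigcap_measurable.
  exact: finite_fset.
by move=> i _; exact: measurable_increment.
Qed.

Lemma probability_cylinder idx w :
  uniq idx -> {in idx, forall i, i.1.1 \in source d} -> size w = size idx ->
  P (cylinder idx w) = ((#|{: step}|%:R^-1) ^+ size idx)%:E.
Proof.
move=> uidx sidx wi; case: XP => Xe Xi; rewrite cylinderE//.
rewrite (Xi [fset i in idx]%fset (fun i => [set step_vec (nth e0 w (index i idx))])).
- rewrite (eq_big_seq (fun=> ((2 * d)%:R^-1)%:E)); last first.
    move=> i; rewrite inE => ii.
    exact: (Xe i.1 i.2 _ (sidx _ ii) (unit_step_vec (nth e0 w (index i idx)))).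
  rewrite prodEFin big_const_seq count_predT iter_mulr_1 card_steps.
  by rewrite -[size (enum_fset _)]/(#|` [fset i in idx]|)%fset card_fseq undup_id.
- by move=> i /=; rewrite inE => /sidx.
- by move=> i _.
Qed.

(** The event [U] is the complement of the union of the cylinders of the words
that avoid [Q].  These cylinders are disjoint, and those of all the words have
total mass 1; hence the mass of [U] is the proportion of words in [Q], and the
null set on which some increment is not a unit step lies in [U]. *)
Lemma word_event idx (Q : pred (seq step)) :
  uniq idx -> {in idx, forall i, i.1.1 \in source d} ->
  exists U : set Omega, [/\ measurable U,
    P U = (mean (size idx) (fun w => (Q w)%:R))%:E &
    forall om, ~ U om -> exists w : seq step, [/\ size w = size idx,
      increments om idx = map (@step_vec d) w & ~~ Q w]].
Proof.
move=> uidx sidx.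
pose F (w : (size idx).-tuple step) := cylinder idx w.
pose D := [set w : (size idx).-tuple step | ~~ Q w].
have mF w : measurable (F w) by apply: measurable_cylinder; rewrite ?size_tuple.
have tF : trivIset D F.
  move=> u v _ _ [om [/= uo vo]]; apply/val_inj.
  by apply: (inj_map (@step_vec_inj d)); rewrite -[LHS]uo -[RHS]vo.
have mV : measurable (\bigcup_(w in D) F w).
  by apply: fin_bigcup_measurable => //; exact: finite_finset.
exists (~` \bigcup_(w in D) F w); split.
- exact: measurableC.
- rewrite probability_setC// measure_fin_bigcup//; last exact: finite_finset.
  rewrite /D -(@bigfs _ _ _ _ (index_enum _)
    (fun w : (size idx).-tuple step => ~~ Q w)) ?index_enum_uniq//; last first.
    by move=> w _; rewrite mem_index_enum.
  rewrite (eq_bigr (fun=> ((#|{: step}|%:R^-1) ^+ size idx)%:E)); last first.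
    by move=> w _; apply: probability_cylinder; rewrite ?size_tuple.
  rewrite sumEFin -EFinB; congr (_%:E).
  rewrite -[X in X - _](mean_cst (card_steps_gt0 d0) (size idx)) !mean_tuple.
  rewrite [X in _ - X]big_mkcond !mulr_sumr -sumrB; apply: eq_bigr => w _.
  by case: (Q w) => /=; rewrite ?mulr1 ?mulr0 ?subr0 ?subrr.
- move=> om /contrapT[w /= Qw omw]; exists w; split => //.
  by rewrite size_tuple.
Qed.

End Cylinders.

(** * The aggregate up to a given level *)

Section Process.
Variables d n : nat.
Let step := ('I_d * bool)%type.
Implicit Types (u : seq step) (v : nat -> site d) (z : site d) (A : seq (site d)).

Definition traces z u v :=
  forall t, (t <= size u)%N -> v t = z + displacement (take t u).

Lemma exit_time A z u v : traces z u v -> ~~ confined A z u ->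
  exists k, [/\ (k <= size u)%N, v k = exit_site A z u, v k \notin A &
    forall j, (j < k)%N -> v j \in A].
Proof.
move=> uv; rewrite /confined -has_predC => hA.
have kle : (find (predC (mem A)) (visited z u) <= size u)%N.
  by move: hA; rewrite has_find size_visited ltnS.
have vk : v (find (predC (mem A)) (visited z u)) = exit_site A z u.
  by rewrite uv// /exit_site nth_visited.
exists (find (predC (mem A)) (visited z u)); split => //.
  by rewrite vk; have := nth_find z hA.
move=> j jk; have := before_find z jk.
have ju : (j <= size u)%N by apply: leq_trans kle; exact: ltnW.
by rewrite nth_visited// -uv// => /negbFE.
Qed.

Lemma settle_exit A z u v : traces z u v -> ~~ confined A z u ->
  settle [set` A] v = [set` exit_site A z u :: A].
Proof.
move=> uv cA; have [k [ku <- vkA jA]] := exit_time uv cA.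
apply/seteqP; split=> y /=; rewrite inE.
  move=> [/= ->|[t [/= /negP tA sA] <-]]; first by rewrite orbT.
  have [tk|kt|->] := ltngtP t k; last by rewrite eqxx.
    by rewrite (jA _ tk) in tA.
  by have := sA _ kt; rewrite (negbTE vkA).
move=> /orP[/eqP ->|]; last by left.
by right; exists k => //; split => //; exact/negP.
Qed.

Lemma trajectory_exit A z u v y : traces z u v -> ~~ confined A z u ->
  trajectory [set` A] v y -> exists2 t, (t <= size u)%N & y = v t.
Proof.
move=> uv cA; have [k [ku _ vkA jA]] := exit_time uv cA.
move=> [t /= sA <-]; exists t => //; apply: leq_trans ku.
by rewrite leqNgt; apply/negP => kt; move/negP: vkA; apply; exact: sA.
Qed.

Fixpoint follows T (w : particle d n -> nat -> site d) ps (W : seq step) : Prop :=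
  if ps is p :: ps' then traces p.1 (take T W) (w p) /\ follows T w ps' (drop T W)
  else True.

(** When no block is bad, every walk settles within its [T] steps, at the site
computed from its block; so the aggregates of [bad_run] are the true ones and
each trajectory is a part of the corresponding block. *)
Lemma trajectory_good_run r T w A s1 p s2 (W : seq step) y i :
  follows T w (s1 ++ p :: s2) W ->
  ~~ bad_run r T A [seq q.1 | q <- s1 ++ p :: s2] W ->
  trajectory (send w [set` A] s1) (w p) y ->
  (`|y ord0 i - p.1 ord0 i| < r)%N.
Proof.
elim: s1 A W => [|q s1 IH] A W /= [fW1 fW2]; rewrite negb_or /bad negb_or.
  move=> /andP[/andP[cA fr] _] yA.
  have [t tu ->] := trajectory_exit fW1 cA yA.
  rewrite ltnNge; apply: contra fr => ri.
  apply/hasP; exists (0 + displacement (take t (take T W))).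
    by apply/mapP; exists t => //; rewrite mem_iota add0n ltnS.
  apply/existsP; exists i; rewrite add0r; apply: leq_trans ri _.
  by rewrite (fW1 _ tu) mxE addrAC subrr add0r.
move=> /andP[/andP[cA _] br].
by rewrite (settle_exit fW1 cA); exact: IH fW2 br.
Qed.

Lemma displacement_map u :
  displacement u = \sum_(y <- map (@step_vec d) u) y.
Proof. by rewrite big_map. Qed.

Lemma follows_walk (disp : measure_display) (Omega : measurableType disp)
    (R : realType) (P : probability Omega R)
    (X : particle d n -> nat -> {RV P >-> site d}) om T ps (W : seq step) :
  increments X om [seq (p, s) | p <- ps, s <- iota 0 T] = map (@step_vec d) W ->
  follows T (walk X om) ps W.
Proof.
elim: ps W => [//|p ps IH] W /=; rewrite /increments map_cat => XW.
have sT : size [seq X i.1 i.2 om | i <- [seq (p, s) | s <- iota 0 T]] = T.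
  by rewrite !size_map size_iota.
split; last first.
  by apply: IH; rewrite map_drop -XW drop_size_cat.
have XT : map (@step_vec d) (take T W) = [seq X p s om | s <- iota 0 T].
  by rewrite map_take -XW take_size_cat// -map_comp.
move=> t tT; rewrite /walk displacement_map map_take XT -map_take take_iota.
have tT' : (t <= T)%N.
  by apply: leq_trans tT _; rewrite size_take; case: ltnP => // ?; lia.
rewrite (minn_idPl tT') big_map -(big_mkord xpredT (fun s => X p s om)).
by rewrite /index_iota subn0.
Qed.

Definition particles_below L : seq (particle d n) :=
  flatten [seq level_particles d n M | M <- iota 0 L].

Lemma particles_belowD K L : exists s,
  particles_below (K + L) = particles_below K ++ s.
Proof. by rewrite /particles_below iotaD map_cat flatten_cat; eexists. Qed.

Lemma particles_belowS L :
  particles_below L.+1 = particles_below L ++ level_particles d n L.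
Proof.
by rewrite /particles_below -addn1 iotaD map_cat flatten_cat /= cats0.
Qed.

Lemma aggregateE w L : aggregate w L = send w set0 (particles_below L.+1).
Proof.
elim: L => [|L IH]; first by rewrite particles_belowS.
by rewrite particles_belowS /send foldl_cat /= -/(send _ _ _) IH.
Qed.

(** The construction is a single pass over the list of all particles: the
aggregate found by a particle is produced by those that precede it. *)
Lemma current_aggregateE w L K p : (L < K)%N -> p \in level_particles d n L ->
  exists s1 s2, particles_below K = s1 ++ p :: s2 /\
    current_aggregate w L p = send w set0 s1.
Proof.
move=> LK pL; have [s es] := particles_belowD L.+1 (K - L.+1).
set i := index p (level_particles d n L).
exists (particles_below L ++ take i (level_particles d n L)),
  (drop i.+1 (level_particles d n L) ++ s); split.
  rewrite subnKC// in es; rewrite es particles_belowS -!catA; congr (_ ++ _).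
  rewrite -cat_cons catA; congr (_ ++ _).
  by rewrite -(nth_index p pL) -drop_nth ?index_mem// cat_take_drop.
rewrite /current_aggregate /send foldl_cat -!/(send _ _ _).
by rewrite {}/i {es LK pL}; case: L => [//|L]; rewrite aggregateE.
Qed.

Lemma mem_level_particles L p :
  (p \in level_particles d n L) = (p.1 \in source d) && (norm p.1 == L).
Proof.
rewrite -mem_level; apply/allpairsP/idP => [[[z k] [/= zL _ ->]]//|pL].
by exists (p.1, p.2); split => //; [rewrite mem_enum | case: p pL].
Qed.

Lemma mem_particles_below L p :
  (p \in particles_below L) = (p.1 \in source d) && (norm p.1 < L)%N.
Proof.
elim: L => [|L IH]; first by rewrite andbF.
rewrite particles_belowS mem_cat IH mem_level_particles -andb_orr.
by rewrite [(_ < L.+1)%N]leq_eqVlt eqSS orbC ltnS.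
Qed.

Lemma uniq_particles_below L : uniq (particles_below L).
Proof.
elim: L => [//|L IH]; rewrite particles_belowS cat_uniq IH /=.
apply/andP; split.
  apply/hasPn => p; rewrite mem_level_particles inE mem_particles_below.
  by move=> /andP[_ /eqP ->]; rewrite ltnn andbF.
by apply: allpairs_uniq; rewrite ?uniq_level ?enum_uniq// => -[? ?] [? ?] _ _ /= [-> ->].
Qed.

End Process.

(** A source is determined by its last d coordinates, the first one being
zero. *)
Lemma size_particles_below d n L :
  (size (particles_below d.+1 n L) <= n * L.*2.+1 ^ d)%N.
Proof.
pose f (p : particle d.+1 n) : {ffun 'I_d -> 'I_(L.*2.+1)} * 'I_n :=
  ([ffun j => inord (absz (p.1 ord0 (lift ord0 j) + L%:Z))], p.2).
have -> : (n * L.*2.+1 ^ d)%N = #|{: {ffun 'I_d -> 'I_(L.*2.+1)} * 'I_n}|.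
  by rewrite card_prod card_ffun !card_ord mulnC.
rewrite -(size_map f) cardE; apply: uniq_leq_size; last first.
  by move=> p _; rewrite mem_enum.
rewrite map_inj_in_uniq ?uniq_particles_below// => -[y k] [z l].
rewrite !mem_particles_below /= => /andP[/forallP sy ny] /andP[/forallP sz nz].
move=> [/ffunP fyz <-]; congr (_, _); apply/rowP => i.
case: (unliftP ord0 i) => [j ->|->]; last first.
  by rewrite (eqP (implyP (sy ord0) _))// (eqP (implyP (sz ord0) _)).
have := congr1 val (fyz j); rewrite !ffunE /=.
have := leq_trans (leq_norm y (lift ord0 j)) (ltnW ny).
have := leq_trans (leq_norm z (lift ord0 j)) (ltnW nz).
move: (y ord0 _) (z ord0 _) => a b ha hb.
by rewrite !inordK; clear -ha hb; lia.
Qed.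

(** * Scales, blocks and the theorem *)

Section Scales.
Local Open Scope nat_scope.

(** With a the quotient of l by k+1, one has a + 1 <= 2^a, so that
l <= (k+1) 2^a. *)
Lemma leq_expn_exp2 k l : l ^ k.+1 <= k.+1 ^ k.+1 * 2 ^ l.
Proof.
set a := l %/ k.+1.
have la : l <= k.+1 * 2 ^ a.
  apply: leq_trans (_ : k.+1 * a.+1 <= _); first by rewrite mulnC ltnW// ltn_ceil.
  by rewrite leq_mul2l ltn_expl.
apply: leq_trans (_ : (k.+1 * 2 ^ a) ^ k.+1 <= _); first by rewrite leq_exp2r.
by rewrite expnMn leq_mul2l -expnM leq_exp2l// leq_divM orbT.
Qed.

Lemma leq_poly_exp2 c k l : 0 < l -> c * k.+1 ^ k.+1 <= l -> c * l ^ k <= 2 ^ l.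
Proof.
move=> l0 cl; rewrite -(leq_pmul2l l0).
apply: leq_trans (_ : c * l ^ k.+1 <= _); first by rewrite expnS mulnCA.
apply: leq_trans (leq_mul (leqnn c) (leq_expn_exp2 k l)) _.
by rewrite mulnA leq_mul2r cl orbT.
Qed.

(** In dimension e+1, [N] bounds the number of particles of level less than
(l+1)^(4(e+1)).  The second claim says that l^(8e+1) steps suffice to leave a
set of [N] sites with probability 1/2: its left side is of order l^(8(e+1)e)
and its right side is at least l^(8(e+1)e + e + 1).  The third one compares
2 l m, for m = l^(4e+2), with the distance to be travelled. *)
Lemma scales e n : exists l0, forall l, l0 <= l ->
  let N := n * (l.+1 ^ (4 * e.+1)).*2.+1 ^ e in
  [/\ 4 < l, 4 * N ^ 2 * (2 * e.+1) ^ e.+1 <= (l ^ (8 * e + 1)).+1 ^ e.+1,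
      2 * l * l ^ (4 * e + 2) <= (l ^ (4 * e.+1))./2 &
      N * (1 + 4 * e.+1 * (l ^ 3 * l ^ (8 * e + 1)).+1) <= 2 ^ l].
Proof.
pose C := n * (3 * 2 ^ (4 * e.+1)) ^ e.
pose c1 := 4 * C ^ 2 * (2 * e.+1) ^ e.+1.
pose K := 4 * e.+1 * e + (8 * e + 4).
pose c2 := C * (9 * e.+1) * K.+1 ^ K.+1.
exists (5 + c1 + c2) => l ll N.
have l5 : 4 < l by lia.
have l0 : 0 < l by lia.
have NC : N <= C * l ^ (4 * e.+1 * e).
  rewrite /N /C -mulnA leq_mul2l (expnM l) -expnMn; apply/orP; right.
  have [->//|e0] := posnP e; rewrite leq_exp2r// -mulnA -expnMn.
  have : l.+1 ^ (4 * e.+1) <= (2 * l) ^ (4 * e.+1) by rewrite leq_exp2r//; lia.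
  have : 0 < l.+1 ^ (4 * e.+1) by rewrite expn_gt0.
  by lia.
split => //.
- apply: leq_trans (_ : c1 * l ^ (8 * e.+1 * e) <= _).
    rewrite /c1 [leqRHS](_ : _ = 4 * (C * l ^ (4 * e.+1 * e)) ^ 2 * (2 * e.+1) ^ e.+1).
      by rewrite leq_mul2r leq_mul2l leq_sqr NC !orbT.
    rewrite (_ : 8 * e.+1 * e = 4 * e.+1 * e * 2); last by ring.
    by rewrite expnM; ring.
  apply: leq_trans (_ : (l ^ (8 * e + 1)) ^ e.+1 <= _); last by rewrite leq_exp2r.
  apply: leq_trans (_ : l * l ^ (8 * e.+1 * e) <= _).
    by rewrite leq_mul2r; apply/orP; right; lia.
  by rewrite -expnS -expnM leq_exp2l//; lia.
- rewrite geq_half_double -mul2n -mulnA -expnS.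
  rewrite (_ : 4 * e.+1 = (4 * e + 2).+2); last by lia.
  rewrite [leqRHS]expnS mulnA leq_mul2r; apply/orP; right; lia.
- set T := l ^ 3 * l ^ (8 * e + 1).
  have T0 : 0 < T by rewrite muln_gt0 !expn_gt0 l0.
  apply: leq_trans (_ : C * l ^ (4 * e.+1 * e) * (9 * e.+1 * T) <= _).
    apply: leq_mul => //; have := leq_pmulr e.+1 T0.
    by rewrite -!mulnA mulnS mulnDr; move: (e.+1 * T) => x; lia.
  rewrite (_ : C * _ * _ = C * (9 * e.+1) * l ^ K).
    by apply: leq_poly_exp2 => //; rewrite -/c2; lia.
  by rewrite /T -expnD /K [in RHS]expnD (_ : 3 + (8 * e + 1) = 8 * e + 4); [ring|lia].
Qed.

End Scales.

Section Blocks.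
Variables (disp : measure_display) (Omega : measurableType disp).
Variables (R : realType) (P : probability Omega R) (e n : nat).
Variable X : particle e.+1 n -> nat -> {RV P >-> site e.+1}.
Hypothesis XP : srw_increments X.

Definition no_long_trajectory r K om :=
  forall L p y i, (L < K)%N -> p \in level_particles e.+1 n L ->
    trajectory (current_aggregate (walk X om) L p) (walk X om p) y ->
    (`|y ord0 i - p.1 ord0 i| < r)%N.

(** There are at most N particles, and each of them is bad with probability at
most (1 + 4 d (T + 1)) 2^(-2l); by the last claim of [scales] half of the
exponent pays for the polynomial factor. *)
Lemma long_trajectory_event : exists l0, forall l, (l0 <= l)%N ->
  exists U : set Omega, [/\ measurable U, (P U <= (2^-1 ^+ l)%:E)%E &
    forall om, ~ U om ->
      no_long_trajectory (l ^ (4 * e.+1))./2 (l.+1 ^ (4 * e.+1)) om].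
Proof.
have [l0 Hl0] := scales e n; exists l0 => l /Hl0[l4 cN ck cT].
set K := (l.+1 ^ _)%N in cN cT *; set r := _./2 in ck *.
set N := (n * K.*2.+1 ^ e)%N in cN cT.
set T := (l ^ 3 * l ^ (8 * e + 1))%N in cT.
have lpos : (0 < l)%N by exact: leq_trans l4.
pose ps := particles_below e.+1 n K.
have psN : (size ps <= N)%N := size_particles_below e n K.
pose idx := [seq (p, s) | p <- ps, s <- iota 0 T].
have uidx : uniq idx.
  apply: allpairs_uniq; rewrite ?uniq_particles_below ?iota_uniq//.
  by move=> [? ?] [? ?] _ _ /= [-> ->].
have sidx : {in idx, forall i, i.1.1 \in source e.+1}.
  move=> i /allpairsP[[p s] [/= pp _ ->]] /=.
  by move: pp; rewrite mem_particles_below => /andP[].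
have [U [mU PU UP]] := word_event (ltn0Sn e) XP
  (bad_run r T [::] [seq p.1 | p <- ps]) uidx sidx.
exists U; split => //.
  rewrite PU lee_fin size_allpairs size_iota.
  pose delta : R := (1 + 4 * e.+1 * T.+1)%:R * 2^-1 ^+ (2 * l).
  have badB (B : seq (site e.+1)) z : (size B <= N)%N -> mean T (fun w => (bad r B z w)%:R : R) <= delta.
    move=> BN; apply: (@mean_bad R e.+1 (ltn0Sn e) (l ^ (4 * e + 2)) (2 * l) r
      (l ^ (8 * e + 1)) (l ^ 3) B z) => //.
    - apply: leq_trans cN; rewrite leq_mul2r leq_mul2l; apply/orP; right.
      by rewrite leq_sqr BN orbT.
    - by rewrite expn_gt0 lpos.
    - by rewrite -expnD -expnM leq_exp2l ?(ltn_trans _ l4)//; lia.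
    - by rewrite expnSr leq_mul2r; apply/orP; right; rewrite expnS expn1; nia.
  have := mean_bad_run (ltn0Sn e) (zs := [seq p.1 | p <- ps]) (A := [::]) badB.
  rewrite /= add0n size_map => /(_ psN) /le_trans; apply.
  apply: (@le_trans _ _ ((2 ^ l)%:R * 2^-1 ^+ (2 * l))).
    rewrite mulrA -natrM ler_wpM2r ?exprn_ge0 ?invr_ge0// ler_nat.
    by apply: leq_trans cT; rewrite leq_mul2r psN orbT.
  by rewrite mul2n -addnn exprD mulrA natrX -exprMn mulfV ?expr1n ?mul1r.
move=> om /UP[W [sW omW gW]] L p y i LK pL yL.
have fW := follows_walk omW.
have [s1 [s2 [es es1]]] := current_aggregateE (walk X om) LK pL.
rewrite -/ps in es; rewrite es in fW gW.
apply: (trajectory_good_run i fW gW).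
by rewrite set_nil -es1.
Qed.

Lemma eventually_no_long_trajectory :
  {ae P, forall om, exists l1, forall l, (l1 <= l)%N ->
     no_long_trajectory (l ^ (4 * e.+1))./2 (l.+1 ^ (4 * e.+1)) om}.
Proof.
have [l0 Hl0] := long_trajectory_event.
have HF l : exists U : set Omega, [/\ measurable U, (P U <= (2^-1 ^+ l)%:E)%E &
    forall om, (l0 <= l)%N -> ~ U om ->
      no_long_trajectory (l ^ (4 * e.+1))./2 (l.+1 ^ (4 * e.+1)) om].
  have [/Hl0[U [? ? ?]]|ll] := leqP l0 l; first by exists U; split => // om _; auto.
  exists set0; split => //; first by rewrite measure0 lee_fin exprn_ge0 ?invr_ge0.
have [F FP] := choice HF.
exists (lim_sup_set F); split.
- apply: bigcap_measurable => // k _; apply: bigcup_measurable => j _.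
  by have [] := FP j.
- apply: lim_sup_set_cvg0 => [k|]; first by have [] := FP k.
  apply: (@le_lt_trans _ _ 2%:E); last exact: ltry.
  apply: le_trans (epsilon_trick0 xpredT _); last by [].
  apply: lee_nneseries => // i _; have [_ + _] := FP i.
  by rewrite expnS natrM invfM mulrA mulfV// mul1r natrX exprVn.
- move=> om /= nom; apply: contrapT => nlim; apply: nom.
  have /existsNP[l1 /not_implyP[_ nl1]] : ~ (forall k, True -> (\bigcup_(j >= k) F j) om) by [].
  exists (maxn l0 l1) => l; rewrite geq_max => /andP[l0l l1l].
  have [_ _] := FP l; apply => // Fl.
  by apply: nl1; exists l.
Qed.

End Blocks.

Lemma powR_ge_double (R : realType) (alpha : R) : 1 < alpha ->
  exists M0 : nat, forall M : nat, (M0 <= M)%N -> M%:R *+ 2 <= M%:R `^ alpha.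
Proof.
move=> a1; have a10 : 0 < alpha - 1 by rewrite subr_gt0.
(* M^alpha = M^(alpha - 1) M, and M^(alpha - 1) >= 2 from M = x on. *)
pose x : R := 2 `^ (alpha - 1)^-1.
exists (Num.truncn x).+1 => M xM.
have xM' : x <= M%:R.
  by rewrite ltW// (lt_le_trans (truncnS_gt x))// ler_nat.
have M0 : 0 < M%:R :> R by rewrite ltr0n (leq_trans _ xM).
have -> : M%:R `^ alpha = M%:R `^ (alpha - 1) * M%:R.
  rewrite -[X in _ * X](powRr1 (ltW M0)) -powRD ?subrK//.
  by rewrite (gt_eqF M0) implybT.
rewrite -mulr_natl ler_wpM2r ?(ltW M0)//.
have -> : 2 = x `^ (alpha - 1) :> R.
  by rewrite -powRrM mulVf ?gt_eqF// powRr1.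
by apply: ge0_ler_powR; rewrite ?nnegrE ?powR_ge0 ?(ltW a10) ?(ltW M0).
Qed.

Lemma exists_coord_norm d (z : site d) : (0 < norm z)%N ->
  exists i, `|z ord0 i|%N = norm z.
Proof.
move=> z0; have d0 : (0 < #|'I_d|)%N.
  by rewrite card_ord; case: d z z0 => // z; rewrite /norm big_ord0.
by have [i e] := bigop.eq_bigmax (fun i => `|z ord0 i|%N) d0; exists i; rewrite -e.
Qed.

Theorem theorem1p2 (disp : measure_display) (Omega : measurableType disp)
    (R : realType) (P : probability Omega R) (d n : nat) (alpha : R)
    (X : particle d n -> nat -> {RV P >-> site d}) :
  (3 <= d)%N -> 1 < alpha -> srw_increments X ->
  {ae P, forall omega : Omega,
    exists M0 : nat, forall M : nat, (M0 <= M)%N ->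
      forall (L : nat) (p : particle d n),
        M%:R `^ alpha < L%:R -> p \in level_particles d n L ->
        trajectory (current_aggregate (walk X omega) L p) (walk X omega p)
          `&` strip (M%:R : R) = set0}.
Proof.
case: d X => [//|e] X d3 a1 XP.
have [M1 M1P] := powR_ge_double a1.
apply: filterS (eventually_no_long_trajectory XP) => om [l1 l1P].
set D := (4 * e.+1)%N in l1P.
exists (maxn M1 (l1 ^ D).+1) => M; rewrite geq_max => /andP[M1M lM] L p ML pL.
have M2L : (M.*2 < L)%N.
  by rewrite -(ltr_nat R) -addnn natrD -mulr2n (le_lt_trans (M1P _ M1M)).
apply/seteqP; split => // y [yL yM].
have [l [ll lL Ll]] : exists l, [/\ (l1 <= l)%N, (l ^ D <= L)%N & (L < l.+1 ^ D)%N].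
  (* The block of L: the largest l such that l^D <= L. *)
  have exl : exists l, (l ^ D <= L)%N by exists l1; lia.
  have bl l : (l ^ D <= L)%N -> (l <= L)%N.
    by apply: leq_trans; rewrite -{1}[l]expn1; case: l => // l; rewrite leq_pexp2l.
  case: (ex_maxnP exl bl) => l lL lmax; exists l; split => //.
    by apply: lmax; lia.
  by rewrite ltnNge; apply/negP => /lmax; rewrite ltnn.
move: pL (pL); rewrite {1}mem_level_particles => /andP[sp /eqP np] pL.
have [i pi] : exists i, `|p.1 ord0 i|%N = norm p.1.
  by apply: exists_coord_norm; rewrite np; lia.
have := l1P _ ll L p y i Ll pL yL.
have i0 : val i != 0%N.
  apply/eqP => i0; move/forallP: sp => /(_ i); rewrite i0 eqxx => /eqP p0.
  by move: M2L; rewrite -np -pi p0.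
have floorM : Num.floor (M%:R : R) = M%:Z.
  by apply/eqP; rewrite floor_eq intrD1 lexx ltrDl ltr01.
have := yM i i0; rewrite floorM.
move: pi; rewrite np.
move: (y ord0 i) (p.1 ord0 i) => a b; lia.
Qed.
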